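(* $$M(x,\ell(x)^{-1})=\frac1{\ell(x)}\,\mathcal D_2(x)\,P\,\mathcal D_1(x),$$ where, with $A(x)=M(x,0)$, $\mathcal D_1(x)=\mathrm{diag}(A(x)_{2n,1},A(x)_{2n,2},\dots,A(x)_{2n,2n})$, $\mathcal D_2(x)=\mathrm{diag}(A(x)_{1,1},A(x)_{2,1},\dots,A(x)_{2n,1})$, and $P$ is the $2n\times2n$ matrix with all entries equal to $1$.
   Context: Let $n\ge 4$. $x=(x_1,\dots,x_n,\bar x_{n-1},\dots,\bar x_1)$ are real variables; identities are between rational functions (hold wherever both sides are defined). Level $\ell(x)=x_1\cdots x_n\bar x_{n-1}\cdots\bar x_1$; $\delta_{ij}$ Kronecker delta; empty products are $1$. **The $2n\times 2n$ matrix $M(x,z)$.** Write $M_{i,j}=M(x,z)_{i,j}$, $\ell=\ell(x)$, $\bar X_i=1+\bar x_i/x_i$. First column: $M_{1,1}=x_1/\bar x_1$; $M_{i,1}=x_1\cdots x_{i-1}(1+x_i/\bar x_i)$ for $2\le i\le n-1$; $M_{n,1}=x_1\cdots x_n$; $M_{n+1,1}=x_1\cdots x_{n-1}$; $M_{i,1}=\ell/(\bar x_1\cdots\bar x_{2n-i})$ for $n+2\le i\le 2n$. Other columns ($1\le i\le 2n$): $M_{i,j+1}=\frac{M_{i,j}}{x_j}+(\ell z-1)\big(\frac{\delta_{i,j}}{\bar x_j}+\delta_{i,j+1}\big)$ for $1\le j\le n-2$; $M_{i,n}=\frac{M_{i,n-1}}{x_{n-1}}+(\ell z-1)\big(\frac{\delta_{i,n-1}}{\bar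 x_{n-1}}+\delta_{i,n+1}\big)$; $M_{i,n+1}=\frac{M_{i,n-1}}{x_{n-1}x_n}+(\ell z-1)\big(\frac{\delta_{i,n-1}}{\bar x_{n-1}x_n}+\delta_{i,n}\big)$; $M_{i,2n}=z\frac{\bar x_1}{x_1}M_{i,1}+\delta_{i,2n}\frac{\bar x_1}{x_1}(1-\ell z)+\delta_{i,1}z(\ell z-1)$; $M_{i,2n-1}=z\bar x_1\bar X_2M_{i,1}+(1-\ell z)\big(\delta_{i,2n}\bar x_1\bar X_2+\delta_{i,2n-1}\frac{\bar x_2}{x_2}\big)$; $M_{i,2n-j}=\bar x_j\frac{\bar X_{j+1}}{\bar X_j}M_{i,2n+1-j}+(1-\ell z)\big(\delta_{i,2n+1-j}\bar x_j\frac{\bar X_{j+1}}{\bar X_j}+\delta_{i,2n-j}\frac{\bar x_{j+1}}{x_{j+1}}\big)$ for $2\le j\le n-2$. $M(x,z)$ is a polynomial in $z$ of degree at most $2$, and $A(x)$ denotes its coefficient of degree $0$. *)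

(* Defs.v *)
From HB Require Import structures.
From mathcomp Require Import all_boot all_order all_algebra.
Set Implicit Arguments.
Unset Strict Implicit.
Unset Printing Implicit Defensive.
Import GRing.Theory.
Local Open Scope ring_scope.

(* All indices are natural numbers counted from 1; they are shifted only where
   tuples and matrices are read or built.  *)

Section Definitions.
Variables (F : fieldType) (n : nat).

(* The tuple lists x_1, ..., x_n, xbar_(n-1), ..., xbar_1, so that xbar_i is
   its (2n - i)-th coordinate. *)
Implicit Type x : ((2 * n).-1).-tuple F.
Implicit Type z : F.
Implicit Types i j : nat.

Definition xc x i : F := x`_(i.-1).
Definition xbar x i : F := x`_((2 * n - i).-1).

Definition level x : F :=
  (\prod_(1 <= i < n.+1) xc x i) * (\prod_(1 <= i < n) xbar x i).

Definition Xbar x i : F := 1 + xbar x i / xc x i.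

Definition delta i j : F := (i == j)%:R.

Definition Mfirst x i : F :=
  if i == 1%N then xc x 1 / xbar x 1
  else if (i <= n - 1)%N then
    (\prod_(1 <= k < i) xc x k) * (1 + xc x i / xbar x i)
  else if i == n then \prod_(1 <= k < n.+1) xc x k
  else if i == (n + 1)%N then \prod_(1 <= k < n) xc x k
  else level x / \prod_(1 <= k < (2 * n - i).+1) xbar x k.

(* [Mleft x z i j] is M_(i,j) for 1 <= j <= n - 1. *)
Fixpoint Mleft x z i j : F :=
  match j with
  | 0 | 1 => Mfirst x i
  | j0.+1 =>
      Mleft x z i j0 / xc x j0
      + (level x * z - 1) * (delta i j0 / xbar x j0 + delta i j0.+1)
  end.

(* [Mright x z i j] is M_(i,2n-j) for 0 <= j <= n - 2. *)
Fixpoint Mright x z i j : F :=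
  match j with
  | 0 =>
      z * (xbar x 1 / xc x 1) * Mfirst x i
      + delta i (2 * n) * (xbar x 1 / xc x 1) * (1 - level x * z)
      + delta i 1 * z * (level x * z - 1)
  | 1 =>
      z * xbar x 1 * Xbar x 2 * Mfirst x i
      + (1 - level x * z)
        * (delta i (2 * n) * xbar x 1 * Xbar x 2
           + delta i (2 * n - 1) * (xbar x 2 / xc x 2))
  | j0.+1 =>
      xbar x j * (Xbar x j.+1 / Xbar x j) * Mright x z i j0
      + (1 - level x * z)
        * (delta i (2 * n + 1 - j) * xbar x j * (Xbar x j.+1 / Xbar x j)
           + delta i (2 * n - j) * (xbar x j.+1 / xc x j.+1))
  end.

Definition Mentry x z i j : F :=
  if (j <= n - 1)%N then Mleft x z i j
  else if j == n then
    Mleft x z i (n - 1) / xc x (n - 1)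
    + (level x * z - 1)
      * (delta i (n - 1) / xbar x (n - 1) + delta i (n + 1))
  else if j == (n + 1)%N then
    Mleft x z i (n - 1) / (xc x (n - 1) * xc x n)
    + (level x * z - 1)
      * (delta i (n - 1) / (xbar x (n - 1) * xc x n) + delta i n)
  else Mright x z i (2 * n - j).

Definition M x z : 'M[F]_(2 * n) := \matrix_(i, j) Mentry x z i.+1 j.+1.

(* The entries of A(x) = M(x,0), the constant coefficient of M(x,z) in z. *)
Definition Aentry x i j : F := Mentry x 0 i j.

Definition D1 x : 'M[F]_(2 * n) := diag_mx (\row_j Aentry x (2 * n) j.+1).
Definition D2 x : 'M[F]_(2 * n) := diag_mx (\row_j Aentry x j.+1 1).

Definition P : 'M[F]_(2 * n) := const_mx 1.

End Definitions.

Arguments P : clear implicits.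

(* Main.v *)
Require Import Defs.
From mathcomp Require Import all_boot all_order all_algebra.
From mathcomp Require Import zify ring.
Import GRing.Theory.
Local Open Scope ring_scope.

(** At [z = (level x)^-1] every correction term in the recursion for the columns
    of [M x z] vanishes, since each carries the factor [level x * z - 1] up to
    sign.  What remains multiplies whole columns by scalars, so each column is a
    multiple of the first one and the matrix has rank one.

    The scalars can be read in the last row of [M x 0].  In the columns
    [1], ..., [n + 1] the Kronecker deltas of that row are zero, so the row obeys
    the same recursion, started from [M_(2n,1) = level x] ([Mleft_rank1]).  In
    the columns [2n] and [2n - 1] setting [z = 0] kills the multiple of the first
    column, but [delta (2 * n) (2 * n) = 1] supplies the same scalar without its
    factor [z = (level x)^-1]; in the columns between [n + 1] and [2n - 1] the
    deltas are zero again ([Mright_rank1]).  Hence in both halves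
      [M_(i,j)((level x)^-1) = (level x)^-1 * A_(i,1) * A_(2n,j)],
    which is the claim read entrywise. *)

Section RankOne.
Variables (F : fieldType) (n : nat) (x : ((2 * n).-1).-tuple F).

Lemma delta_neq (i j : nat) : i <> j -> delta F i j = 0.
Proof. by move=> /eqP ne_ij; rewrite /delta (negbTE ne_ij). Qed.

Lemma level_neq0
    (hx : forall i : nat, (1 <= i <= n)%N -> xc x i != 0)
    (hbx : forall i : nat, (1 <= i <= n - 1)%N -> xbar x i != 0) :
  level x != 0.
Proof.
rewrite /level mulf_neq0 // prodf_seq_neq0; apply/allP => i;
  rewrite mem_index_iota => i_bounds /=.
  by apply: hx; lia.
by apply: hbx; lia.
Qed.

Lemma Mfirst_last : (2 <= n)%N -> Mfirst x (2 * n) = level x.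
Proof.
move=> n_ge2; rewrite /Mfirst.
do 4 (rewrite ifF; last by lia).
by rewrite subnn big_geq // divr1.
Qed.

Hypotheses (n_ge3 : (3 <= n)%N) (level_n0 : level x != 0).

Let levelV : level x * (level x)^-1 = 1.
Proof. exact: divff. Qed.

Lemma Mleft_rank1 (i j : nat) : (j <= n - 1)%N ->
  Mleft x (level x)^-1 i j
  = (level x)^-1 * Mfirst x i * Mleft x 0 (2 * n) j.
Proof.
have base : Mfirst x i = (level x)^-1 * Mfirst x i * Mfirst x (2 * n).
  by rewrite Mfirst_last 1?mulrAC ?mulVf ?mul1r //; lia.
elim: j => [|[|j] IHj] le_jn //.
rewrite [LHS]/= [in RHS]/= -/(Mleft x _^-1 _ j.+1)
  -/(Mleft x 0 _ j.+1) levelV IHj; last by lia.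
by rewrite !(@delta_neq (2 * n)); [ring | lia..].
Qed.

(** The base cases [j = 0] and [j = 1] are separate because the recursion
    restarts from the first column in both columns [2n] and [2n - 1]. *)
Lemma Mright_rank1 (i j : nat) : (j <= n - 2)%N ->
  Mright x (level x)^-1 i j
  = (level x)^-1 * Mfirst x i * Mright x 0 (2 * n) j.
Proof.
have delta_last : delta F (2 * n) (2 * n) = 1 by rewrite /delta eqxx.
elim: j => [|[|j] IHj] le_jn.
- by rewrite /= levelV delta_last; ring.
- rewrite /= levelV delta_last (@delta_neq (2 * n) (2 * n - 1)); last by lia.
  by ring.
rewrite [LHS]/= [in RHS]/= -/(Mright x _^-1 _ j.+1)
  -/(Mright x 0 _ j.+1) levelV IHj; last by lia.
by rewrite !(@delta_neq (2 * n)); [ring | lia..].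
Qed.

Lemma Mentry_rank1 (i j : nat) :
  Mentry x (level x)^-1 i j
  = (level x)^-1 * Mfirst x i * Mentry x 0 (2 * n) j.
Proof.
rewrite /Mentry; case: ifP => [le_jn | gt_jn]; first exact: Mleft_rank1.
have [_ | ne_jn] := eqVneq j n.
  rewrite levelV Mleft_rank1 // !(@delta_neq (2 * n)); [ring | lia..].
have [_ | ne_jn1] := eqVneq j (n + 1)%N.
  rewrite levelV Mleft_rank1 // !(@delta_neq (2 * n)); [ring | lia..].
by apply: Mright_rank1; lia.
Qed.

End RankOne.

Theorem proposition3p4 (F : fieldType) (n : nat) (hn : (4 <= n)%N)
  (x : ((2 * n).-1).-tuple F)
  (hx : forall i : nat, (1 <= i <= n)%N -> xc x i != 0)
  (hbx : forall i : nat, (1 <= i <= n - 1)%N -> xbar x i != 0)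
  (hX : forall j : nat, (2 <= j <= n - 2)%N -> Xbar x j != 0) :
  M x (level x)^-1 = (level x)^-1 *: (D2 x *m P F n *m D1 x).
Proof.
apply/matrixP => i j; rewrite /D2 /D1 mul_diag_mx mul_mx_diag !mxE mulr1.
have A_first : Aentry x i.+1 1 = Mfirst x i.+1
  by rewrite /Aentry /Mentry ifT //; lia.
rewrite A_first mulrA; apply: Mentry_rank1; first by lia.
exact: level_neq0.
Qed.
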